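(* Let $p$ be a prime, let $d, k \geq 2$ be integers, and let $R = \mathrm{GR}(p^k, d)$ be the Galois ring. Then $\mu_0(R) = k$, $\mu_1(R) = p^{k-1}(p^d - 1)$, there are exactly $p^{k-1}(p^d-1) + k - 1$ distinct power maps over $R$, and the number of distinct periodic power maps over $R$ is $$\mu_P(R) = p^{k-2}(p^d - 1) + \left\lfloor \frac{k-1}{p} \right\rfloor.$$
   Context: $\mathrm{GR}(p^k, d)$ denotes the unique Galois extension of $\mathbb{Z}/p^k\mathbb{Z}$ of degree $d$; it is a finite commutative local ring of characteristic $p^k$ with maximal ideal $(p)$ and residue field $\mathbb{F}_{p^d}$ (concretely, $(\mathbb{Z}/p^k\mathbb{Z})[t]/(g(t))$ with $g$ monic of degree $d$ and irreducible modulo $p$). A power map over a ring $R$ is a function $R \to R$ of the form $f(x) = x^n$ for a fixed positive integer $n$; distinct means distinct as functions. A power map $f$ is periodic if there is a nonzero $h \in R$ with $f(x+h) = f(x)$ for all $x \in R$; $\mu_P(R)$ is the number of distinct periodic power maps over $R$. The exponential period $\mu_1(R)$ is the smallest positive integer $n$ such that for each $x \in R$ there is a positive integer $m(x)$ with $x^{m(x)+n} = x^{m(x)}$. The onset of exponential periodicity is $\mu_0(R) = \max_{x \in R} \min\{m \in \mathbb{N} : x^{m+\mu_1} = x^m\}$, where $\mathbb{N}$ is the set of positive integers. *)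

(* Defs.v *)
From HB Require Import structures.
From mathcomp Require Import all_boot all_order all_algebra.
From mathcomp Require Import boolp.

Set Implicit Arguments.
Unset Strict Implicit.
Unset Printing Implicit Defensive.

Import GRing.Theory.
Local Open Scope ring_scope.

Definition reduce_mod (p k : nat) (a : 'Z_(p ^ k)) : 'F_p := (a : nat)%:R.

(* R is a copy of GR(p^k, d) = (Z/p^k)[t]/(g) with g monic of degree d and
   irreducible modulo p.  Meaningful for p prime, k > 0 and d > 0: then
   'Z_(p ^ k) is Z/p^k, reduce_mod is a ring morphism, and {poly %/ g} is the
   genuine quotient (the library replaces g by 'X if g is constant or not
   monic). *)
Definition galois_ring (p k d : nat) (R : nzRingType) : Prop :=
  exists g : {poly 'Z_(p ^ k)},
    [/\ g \is monic, size g = d.+1,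
        irreducible_poly (map_poly (@reduce_mod p k) g) &
        exists phi : {rmorphism {poly %/ g} -> R}, bijective phi].

Section PowerMaps.
Variable R : finNzRingType.

Definition is_power_map (f : {ffun R -> R}) : Prop :=
  exists2 n : nat, (0 < n)%N & forall x : R, f x = x ^+ n.

Definition is_periodic (f : {ffun R -> R}) : Prop :=
  exists2 h : R, h != 0 & forall x : R, f (x + h) = f x.

Definition power_maps : {set {ffun R -> R}} := [set f | `[< is_power_map f >]].

Definition periodic_power_maps : {set {ffun R -> R}} :=
  [set f in power_maps | `[< is_periodic f >]].

Definition mu_P : nat := #|periodic_power_maps|.

Definition is_exp_period (n : nat) : Prop :=
  (0 < n)%N /\
  forall x : R, exists2 m : nat, (0 < m)%N & x ^+ (m + n) = x ^+ m.

Lemma ex_exp_period : exists n : nat, `[< is_exp_period n >].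
Proof.
exists (#|R| `!)%N; apply/asboolP; split=> [|x]; first exact: fact_gt0.
pose f (i : 'I_(#|R|.+1)) : R := x ^+ i.+1.
have /injectivePn [i [j neq_ij eq_ij]] : ~~ injectiveb f.
  by apply/injectiveP => /leq_card; rewrite card_ord ltnn.
wlog lt_ij : i j neq_ij eq_ij / (i < j)%N => [th|].
  case: (ltngtP i j) => [|lt_ji|/val_inj eqij]; first exact: th.
    by apply: (th j i) => //; rewrite eq_sym.
  by rewrite eqij eqxx in neq_ij.
exists i.+1 => //.
have /dvdnP [t ->] : (j - i %| #|R| `!)%N.
  by apply: dvdn_fact; rewrite subn_gt0 lt_ij (leq_trans (leq_subr _ _)) // -ltnS.
elim: t => [|t IHt]; first by rewrite mul0n addn0.
by rewrite mulSn addnA addSn subnKC ?(ltnW lt_ij) // exprD -[x ^+ j.+1]eq_ij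
  -exprD IHt.
Qed.

Definition mu_1 : nat := ex_minn ex_exp_period.

Lemma ex_onset (x : R) :
  exists m : nat, (0 < m)%N && (x ^+ (m + mu_1) == x ^+ m).
Proof.
rewrite /mu_1; case: ex_minnP => n /asboolP [_ /(_ x) [m m_gt0 eq_m]] _.
by exists m; rewrite m_gt0 eq_m eqxx.
Qed.

Definition mu_0 : nat := \max_(x : R) ex_minn (ex_onset x).

End PowerMaps.

(* Main.v *)
Require Import Defs.
From HB Require Import structures.
From mathcomp Require Import all_boot all_order all_algebra all_field.
From mathcomp Require Import boolp zify ring.

(** Let [M = p ^ (k - 1) * (p ^ d - 1)]. Only two features of the Galois ring
    [R] matter: its characteristic is [p ^ k], and reduction modulo [p] is a
    surjection [rho] of [R] onto a field with [p ^ d] elements with kernel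
    [(p)] ([galois_ring_residue]). An element is then either a unit ([rho x !=
    0]) or a multiple of [p], whose [k]-th power is zero.

    The units have exponent exactly [M]. Raising to the power [p ^ d - 1] maps
    a unit to a principal unit [1 + p y], and [p ^ (k - 1)] kills those
    ([unit_exprM]). Conversely an exponent of the unit group is divisible by [p
    ^ d - 1], by counting roots in the residue field, and by [p ^ (k - 1)],
    because [1 + p y] has that order when [y] is neither 0 nor -1 modulo [p]
    ([principal_unit_order]); such a [y] exists as the residue field has at
    least four elements. So [x ^+ (m + M) = x ^+ m] for all [x] as soon as [m
    >= k], while the powers of [p] itself are not periodic before exponent [k].
    This gives [mu_0] and [mu_1], and shows that the power maps with exponents
    1, ..., [M + k - 1] are pairwise distinct and exhaust all power maps.

    Finally [x ^+ n] is periodic iff [p] divides [n] ([periodic_power_map]), so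
    [mu_P] is the number of multiples of [p] up to [M + k - 1], and [p] divides
    [M] because [k >= 2]. *)

Set Implicit Arguments.
Unset Strict Implicit.
Unset Printing Implicit Defensive.

Import GRing.Theory.
Local Open Scope ring_scope.

(** * The residue field of a Galois ring *)

Section ResidueField.
Variables (p k : nat).
Hypotheses (p_pr : prime p) (k_gt0 : (0 < k)%N).

Let Zpk_cast : (Zp_trunc (p ^ k)).+2 = (p ^ k)%N.
Proof. by rewrite Zp_cast // -(exp1n k) ltn_exp2r // prime_gt1. Qed.

Let Fp_natmod m : m%:R = (m %% (Zp_trunc (p ^ k)).+2)%:R :> 'F_p.
Proof.
by rewrite -[RHS]Fp_nat_mod // modn_dvdm ?Fp_nat_mod // Zpk_cast dvdn_exp.
Qed.

Fact reduce_mod_nmod_morphism : nmod_morphism (@reduce_mod p k).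
Proof.
split=> [|a b]; first by [].
by rewrite /reduce_mod -natrD [in RHS]Fp_natmod.
Qed.

Fact reduce_mod_monoid_morphism : monoid_morphism (@reduce_mod p k).
Proof.
split=> [|a b]; first by [].
by rewrite /reduce_mod -natrM [in RHS]Fp_natmod.
Qed.

HB.instance Definition _ := GRing.isNmodMorphism.Build
  'Z_(p ^ k) 'F_p (@reduce_mod p k) reduce_mod_nmod_morphism.
HB.instance Definition _ := GRing.isMonoidMorphism.Build
  'Z_(p ^ k) 'F_p (@reduce_mod p k) reduce_mod_monoid_morphism.

Local Notation red := (@reduce_mod p k).

Lemma reduce_mod_ker (a : 'Z_(p ^ k)) :
  red a = 0 -> exists b : 'Z_(p ^ k), a = p%:R * b.
Proof.
move/eqP; rewrite /reduce_mod -(dvdn_pcharf (pchar_Fp p_pr)).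
case/dvdnP=> c def_a; exists c%:R.
by rewrite -natrM mulnC -def_a natr_Zp.
Qed.

Definition lift_mod (c : 'F_p) : 'Z_(p ^ k) := (c : nat)%:R.

Lemma lift_modK : cancel lift_mod red.
Proof. by move=> c; rewrite rmorph_nat natr_Zp. Qed.

Lemma reduce_poly_surj (f : {poly 'F_p}) :
  exists h : {poly 'Z_(p ^ k)}, map_poly red h = f.
Proof.
exists (\poly_(i < size f) lift_mod f`_i).
apply/polyP=> i; rewrite coef_map coef_poly; case: ifP => lt_i.
  exact: lift_modK.
by rewrite raddf0 nth_default // leqNgt lt_i.
Qed.

(** The bound on the size makes the quotient by [p] a normal form modulo [g]
    whenever [f] is one. *)
Lemma reduce_poly_ker (f : {poly 'Z_(p ^ k)}) : map_poly red f = 0 ->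
  exists2 h : {poly 'Z_(p ^ k)}, f = p%:R *: h & (size h <= size f)%N.
Proof.
move/polyP=> f0.
have fP i : exists b : 'Z_(p ^ k), f`_i == p%:R * b.
  have [|b ->] := @reduce_mod_ker f`_i; last by exists b.
  by have := f0 i; rewrite coef_map coef0.
exists (\poly_(i < size f) xchoose (fP i)); last exact: size_poly.
apply/polyP=> i; rewrite coefZ coef_poly; case: ifP => lt_i.
  exact/eqP/(xchooseP (fP i)).
by rewrite mulr0 nth_default // leqNgt lt_i.
Qed.

Variables (d : nat) (g : {poly 'Z_(p ^ k)}).
Hypotheses (g_mon : g \is monic) (size_g : size g = d.+1).
Hypothesis gbar_irr : irreducible_poly (map_poly red g).
Local Notation gbar := (map_poly red g).

Let gbar_mi : monic_irreducible_poly gbar.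
Proof. by split=> //; apply: monic_map. Qed.

Let size_gbar : size gbar = size g.
Proof. by rewrite size_map_poly_id0 // (monicP g_mon) rmorph1 oner_eq0. Qed.

Let mk_g : mk_monic g = g.
Proof.
by rewrite /mk_monic g_mon -size_gbar (gbar_irr.1).
Qed.

Let mk_gbar : mk_monic gbar = gbar.
Proof. by rewrite /mk_monic monic_map // (gbar_irr.1). Qed.

(** Elements of [{poly %/ g}] are stored as remainders modulo [g], so this is
    reduction of coefficients applied to the normal form. *)
Definition residue (x : {poly %/ g}) : {poly %/ gbar with gbar_mi} :=
  in_qpoly gbar (map_poly red (x : {poly 'Z_(p ^ k)})).

(** Reduction modulo [p] turns a Euclidean division by [g] into one by [gbar],
    so the remainder may be taken before or after reducing; multiplicativity of
    [residue] is an instance. *)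
Lemma residue_in_qpoly (f : {poly 'Z_(p ^ k)}) :
  residue (in_qpoly g f) = in_qpoly gbar (map_poly red f).
Proof.
apply: val_inj; rewrite /= mk_g mk_gbar.
rewrite [in RHS](Pdiv.RingMonic.rdivp_eq g_mon f) rmorphD rmorphM /=.
by rewrite Pdiv.RingMonic.rmodpD ?Pdiv.RingMonic.rmodp_mull ?add0r ?monic_map.
Qed.

Fact residue_nmod_morphism : nmod_morphism residue.
Proof.
split=> [|x y].
  by rewrite /residue /= raddf0 in_qpoly0.
by rewrite /residue /= rmorphD in_qpolyD.
Qed.

Fact residue_monoid_morphism : monoid_morphism residue.
Proof.
split=> [|x y]; first by rewrite /residue /= rmorph1 in_qpoly1.
have -> : x * y = in_qpoly g ((x : {poly 'Z_(p ^ k)}) * y) by [].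
by rewrite residue_in_qpoly rmorphM /= in_qpolyM.
Qed.

HB.instance Definition _ := GRing.isNmodMorphism.Build
  {poly %/ g} {poly %/ gbar with gbar_mi} residue residue_nmod_morphism.
HB.instance Definition _ := GRing.isMonoidMorphism.Build
  {poly %/ g} {poly %/ gbar with gbar_mi} residue residue_monoid_morphism.

Lemma residue_surj y : exists x, residue x = y.
Proof.
have [h hy] := reduce_poly_surj (y : {poly 'F_p}).
exists (in_qpoly g h); rewrite residue_in_qpoly hy; apply: val_inj => /=.
by apply: in_qpoly_small; apply: size_mk_monic.
Qed.

(** A normal form has degree less than that of [gbar], so its image is zero only
    if all its coefficients vanish modulo [p]. *)
Lemma residue_ker x : residue x = 0 -> exists y, x = p%:R * y.
Proof.
have lt_x : (size (x : {poly 'Z_(p ^ k)}) < size g)%N.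
  by apply: leq_trans (size_mk_monic x) _; rewrite mk_g.
move/(congr1 val); rewrite /= Pdiv.CommonRing.rmodp_small; last first.
  by rewrite mk_gbar size_gbar (leq_ltn_trans _ lt_x) // size_poly.
case/reduce_poly_ker=> h def_x le_h; exists (in_qpoly g h).
apply: val_inj; rewrite mulr_natl raddfMn /= def_x Pdiv.CommonRing.rmodp_small.
  by rewrite scaler_nat.
by rewrite mk_g (leq_ltn_trans _ lt_x).
Qed.

Lemma card_residue : #|{poly %/ gbar with gbar_mi}| = (p ^ d)%N.
Proof. by rewrite card_qfpoly card_Fp // size_gbar size_g. Qed.

Lemma galois_poly_natr_eq0 n : (n%:R == 0 :> {poly %/ g}) = (p ^ k %| n)%N.
Proof.
rewrite -val_eqE /= qpolyC_natr -polyC_natr polyC_eq0.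
by rewrite Zp_nat -val_eqE /= Zpk_cast.
Qed.

End ResidueField.

(** All that is needed from the Galois ring: its characteristic, and a
    surjection onto a field with [p ^ d] elements whose kernel is [(p)]. *)
Lemma galois_ring_residue (p k d : nat) (R : nzRingType) :
    prime p -> (0 < k)%N -> galois_ring p k d R ->
  (forall n, (n%:R == 0 :> R) = (p ^ k %| n)%N) /\
  exists (F : finFieldType) (rho : {rmorphism R -> F}),
    [/\ #|F| = (p ^ d)%N, forall y, exists x, rho x = y
      & forall x, rho x = 0 -> exists y, x = p%:R * y].
Proof.
move=> p_pr k_gt0 [g [g_mon size_g g_irr [phi [psi phiK psiK]]]].
have [psiA psiM] :=
  (can2_zmod_morphism phiK psiK, can2_monoid_morphism phiK psiK).
pose psi' : {rmorphism R -> {poly %/ g}} := HB.pack psi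
  (GRing.isZmodMorphism.Build _ _ psi psiA)
  (GRing.isMonoidMorphism.Build _ _ psi psiM).
split=> [n|].
  rewrite -(galois_poly_natr_eq0 p_pr k_gt0 g) -(rmorph_nat phi).
  by rewrite -[0 in LHS](rmorph0 phi) (inj_eq (can_inj phiK)).
have rhoN := residue_nmod_morphism p_pr k_gt0 g_mon g_irr.
have rhoM := residue_monoid_morphism p_pr k_gt0 g_mon g_irr.
pose rho : {rmorphism {poly %/ g} -> _} := HB.pack
  (residue p_pr k_gt0 g_mon g_irr)
  (GRing.isNmodMorphism.Build _ _ _ rhoN)
  (GRing.isMonoidMorphism.Build _ _ _ rhoM).
eexists; exists (rho \o psi')%FUN; split=> [|y|x].
- exact: card_residue.
- have [x <-] := residue_surj y; exists (phi x); rewrite /= phiK //.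
- case/residue_ker=> y /= def_x; exists (phi y).
  by rewrite -(psiK x) [psi x]def_x rmorphM rmorph_nat.
Qed.

(** * Powers congruent to 1 *)

Lemma expr_gcdn_eq1 (R : comNzRingType) (x : R) m n :
  x ^+ m = 1 -> x ^+ n = 1 -> x ^+ gcdn m n = 1.
Proof.
have [-> xm1 |m_gt0 xm1 xn1] := posnP m; first by rewrite gcd0n.
have [u v def_um _] := egcdnP n m_gt0.
have := congr1 (GRing.exp x) def_um.
by rewrite exprD mulnC (mulnC v) !exprM xm1 xn1 !expr1n mul1r => <-.
Qed.

(** In the binomial expansion the terms of degree 2 to [p.-1] carry a factor
    [p] from the coefficient and at least [p ^ (2 * j)], so only the terms of
    degree 1 and [p] matter modulo [p ^ (j + 2)]. The exponent [(p.-1 * j).-1]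
    vanishes exactly when [p = 2] and [j = 1]; otherwise the last term is
    negligible too and raising to the power [p] preserves [v] modulo [p]. *)
Lemma expr_prime_1D (R : comNzRingType) (p j : nat) (v : R) :
    prime p -> (0 < j)%N ->
  exists w, (1 + p%:R ^+ j * v) ^+ p
    = 1 + p%:R ^+ j.+1 * (v + p%:R ^+ (p.-1 * j).-1 * v ^+ p + p%:R * w).
Proof.
move=> p_pr j_gt0; have := p_pr; case def_p: p => [|[|p']] // _.
rewrite -def_p; set P := p%:R : R.
have [w def_w] : exists w, \sum_(i < p')
    1 ^+ (p - i.+2) * (P ^+ j * v) ^+ i.+2 *+ 'C(p, i.+2) = P ^+ j.+2 * w.
  elim/big_ind: _ => [|x y [wx ->] [wy ->]|i _].
  - by exists 0; rewrite mulr0.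
  - by exists (wx + wy); rewrite mulrDr.
  have /dvdnP[c ->] : (p %| 'C(p, i.+2))%N.
    by apply: prime_dvd_bin; rewrite //= [ltnRHS]def_p !ltnS ltn_ord.
  exists (c%:R * P ^+ (j * i.+2 - j.+1) * v ^+ i.+2).
  rewrite expr1n mul1r exprMn -mulr_natr natrM -exprM.
  rewrite -{1}(@subnK j.+1 (j * i.+2)); last by nia.
  by rewrite exprD [P ^+ j.+2]exprS; ring.
exists w; rewrite exprDn.
pose T i := 1 ^+ (p - i) * (P ^+ j * v) ^+ i *+ 'C(p, i).
have -> : \sum_(i < p.+1) T i = T 0%N + (T 1%N + (\sum_(i < p') T i.+2 + T p)).
  by rewrite [in \sum_(_ < p.+1) _]def_p 2!big_ord_recl big_ord_recr /= def_p.
rewrite [\sum_(i < p') _]def_w /T.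
rewrite bin0 bin1 binn !expr1n !mul1r expr0 expr1.
rewrite !mulr1n -mulr_natl exprMn -exprM.
have -> : (j * p = j.+1 + (p.-1 * j).-1)%N by rewrite def_p; nia.
by rewrite exprD -/P [P ^+ j.+2]exprS [P ^+ j.+1]exprS; ring.
Qed.

(** * Arithmetic of units and non-units *)

Section PowerMapsOfResidueRing.

Variables (p d k : nat) (R : finComNzRingType).
Variables (F : finFieldType) (rho : {rmorphism R -> F}).
Hypotheses (p_pr : prime p) (d_ge2 : (2 <= d)%N) (k_ge2 : (2 <= k)%N).
Hypothesis natr_eq0 : forall n, (n%:R == 0 :> R) = (p ^ k %| n)%N.
Hypothesis card_F : #|F| = (p ^ d)%N.
Hypothesis rho_surj : forall y, exists x, rho x = y.
Hypothesis rho_ker : forall x, rho x = 0 -> exists y, x = p%:R * y.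

Local Notation P := (p%:R : R).
Local Notation M := (p ^ (k - 1) * (p ^ d - 1))%N.

Let p_gt1 : (1 < p)%N. Proof. exact: prime_gt1. Qed.
Let p_gt0 : (0 < p)%N. Proof. exact: ltnW. Qed.
Let k_gt0 : (0 < k)%N. Proof. exact: ltnW. Qed.

Let pd_ge4 : (4 <= p ^ d)%N.
Proof.
apply: (@leq_trans (p ^ 2)); last by rewrite leq_pexp2l.
by rewrite -[4%N]/(2 ^ 2)%N leq_exp2r.
Qed.

Let M_gt0 : (0 < M)%N.
Proof. by rewrite muln_gt0 expn_gt0 p_gt0 subn_gt0 (leq_trans _ pd_ge4). Qed.

Lemma p_expr_eq0 m : (P ^+ m == 0) = (k <= m)%N.
Proof. by rewrite -natrX natr_eq0 dvdn_Pexp2l. Qed.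

Lemma rho_p : rho P = 0.
Proof.
have /eqP Pk0 : P ^+ k == 0 by rewrite p_expr_eq0.
by have /eqP := congr1 rho Pk0; rewrite rmorphXn rmorph0 expf_eq0 k_gt0 => /eqP.
Qed.

Lemma principal_unit_expX (y : R) i :
  exists w, (1 + P * y) ^+ (p ^ i) = 1 + P ^+ i.+1 * w.
Proof.
elim: i => [|i [w IHi]]; first by exists y.
have [w' def_w'] := @expr_prime_1D R p i.+1 w p_pr isT.
by rewrite expnSr exprM IHi def_w'; eexists.
Qed.

Lemma principal_unit_exp (y : R) : (1 + P * y) ^+ (p ^ (k - 1)) = 1.
Proof.
have [w ->] := principal_unit_expX y (k - 1).
have /eqP -> : P ^+ (k - 1).+1 == 0 by rewrite p_expr_eq0 -subSn ?subn1.
by rewrite mul0r addr0.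
Qed.

Lemma residue_unit_exp (y : F) : y != 0 -> y ^+ (p ^ d - 1) = 1.
Proof.
move=> y0; apply: (mulfI y0).
rewrite -exprS -subSn ?subn1 ?expn_gt0 ?p_gt0 //.
by rewrite -card_F expf_card mulr1.
Qed.

(** The power [p ^ d - 1] lands among the principal units, which the power
    [p ^ (k - 1)] kills.  An [x] with [rho x != 0] is thus invertible, and
    [rho x != 0] stands for being a unit throughout. *)
Lemma unit_exprM (x : R) : rho x != 0 -> x ^+ M = 1.
Proof.
move=> x_nz.
have : rho (x ^+ (p ^ d - 1) - 1) = 0.
  by rewrite rmorphB rmorphXn rmorph1 residue_unit_exp ?subrr.
case/rho_ker=> y /eqP; rewrite subr_eq addrC => /eqP def_x.
by rewrite mulnC exprM def_x principal_unit_exp.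
Qed.

Lemma unit_lreg (x : R) : rho x != 0 -> GRing.lreg x.
Proof.
move=> x_nz a b /(congr1 ( *%R (x ^+ M.-1))).
by rewrite !mulrA -exprSr prednK // unit_exprM // !mul1r.
Qed.

Lemma unit_expr_cancel (x : R) m n :
  rho x != 0 -> x ^+ (m + n) = x ^+ m -> x ^+ n = 1.
Proof.
move=> x_nz; rewrite exprD -{2}[x ^+ m]mulr1.
exact: (lregX (unit_lreg x_nz)).
Qed.

Lemma p_expr_unit_eq0 m (u : R) : rho u != 0 -> (P ^+ m * u == 0) = (k <= m)%N.
Proof.
by move=> u_nz; rewrite mulrC (mulrI_eq0 _ (unit_lreg u_nz)) p_expr_eq0.
Qed.

Lemma nonunit_expr_eq0 (x : R) m : rho x = 0 -> (k <= m)%N -> x ^+ m = 0.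
Proof.
case/rho_ker=> y -> le_km; rewrite exprMn.
by have /eqP -> : P ^+ m == 0; rewrite ?p_expr_eq0 // mul0r.
Qed.

Lemma expr_eventually_periodic (x : R) m : (k <= m)%N -> x ^+ (m + M) = x ^+ m.
Proof.
move=> le_km; have [x0|x_nz] := eqVneq (rho x) 0.
  by rewrite !nonunit_expr_eq0 // (leq_trans le_km) // leq_addr.
by rewrite exprD unit_exprM // mulr1.
Qed.

(** With [e = gcdn (p ^ d - 1) n], all [p ^ d - 1] nonzero elements of [F] are
    roots of [X ^ e - 1], so [p ^ d - 1 <= e]. *)
Lemma dvdn_card_units n : (0 < n)%N ->
  (forall y : F, y != 0 -> y ^+ n = 1) -> (p ^ d - 1 %| n)%N.
Proof.
move=> n_gt0 yn1; set q1 := (p ^ d - 1)%N.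
have q1_gt0 : (0 < q1)%N by rewrite subn_gt0 (leq_trans _ pd_ge4).
have g_gt0 : (0 < gcdn q1 n)%N by rewrite gcdn_gt0 q1_gt0.
suffices: (q1 <= gcdn q1 n)%N.
  move=> le_q1; apply/gcdn_idPl/eqP.
  by rewrite eqn_leq le_q1 dvdn_leq ?dvdn_gcdl.
have yg1 (y : F) : y != 0 -> y ^+ gcdn q1 n = 1.
  by move=> y0; apply: expr_gcdn_eq1; [exact: residue_unit_exp | exact: yn1].
have card_nz : #|[pred y : F | y != 0]| = q1.
  by rewrite /q1 -card_F subn1 -(cardC1 (0 : F)); apply: eq_card.
rewrite -[leqLHS]card_nz cardE; apply: (max_unity_roots g_gt0);
  last exact: enum_uniq.
by apply/allP=> y; rewrite mem_enum inE unity_rootE => /yg1 ->.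
Qed.

(** This is where [d >= 2] matters: the field with two elements contains no such
    [y], and the exponent of the units of Z/2^k is a proper divisor of
    [2 ^ (k - 1)] for [k >= 3]. *)
Lemma residue_neq0N1 : exists y : F, (y != 0) && (y + 1 != 0).
Proof.
pose A : {set F} := [set 0; -1].
have: (0 < #|~: A|)%N.
  rewrite -(ltn_add2l #|A|) cardsC addn0 card_F cards2.
  by apply: leq_trans pd_ge4; case: (_ == _).
case/card_gt0P=> y; rewrite !inE negb_or => /andP[y0 y1]; exists y.
by rewrite y0 addr_eq0.
Qed.

(** Each raising of [1 + P * y] to the power [p] gains exactly one factor [P]:
    by [expr_prime_1D] the leading coefficient [w] is unchanged in [F], except
    that for [p = 2] the first squaring turns it into [w * (w + 1)]. The two
    conditions on [rho y] keep it nonzero, so [1 + P * y] has order exactly [p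
    ^ (k - 1)]. *)
Lemma principal_unit_order (y : R) n : rho y != 0 -> rho y + 1 != 0 ->
  (1 + P * y) ^+ n = 1 -> (p ^ (k - 1) %| n)%N.
Proof.
move=> y0 y1 an1; set a := 1 + P * y in an1.
have aX i : exists w, [/\ a ^+ (p ^ i) = 1 + P ^+ i.+1 * w, rho w != 0
    & i = 0%N -> rho w + 1 != 0].
  elim: i => [|i [w [aw w0 w1]]]; first by exists y.
  have [w' def_w'] := @expr_prime_1D R p i.+1 w p_pr isT.
  rewrite expnSr exprM aw def_w'; eexists; split=> //.
  rewrite !rmorphD !rmorphM !rmorphXn /= rho_p mul0r addr0.
  have [e0|e_gt0] := posnP (p.-1 * i.+1).-1; last first.
    by rewrite expr0n gtn_eqF //= mul0r addr0.
  have [p2 i0] : p = 2%N /\ i = 0%N by nia.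
  rewrite e0 mul1r p2 expr2 -{1}[rho w]mulr1 -mulrDr mulf_neq0 //.
  by rewrite addrC w1.
have := expr_gcdn_eq1 an1 (principal_unit_exp y).
case/(dvdn_pfactor _ _ p_pr): (dvdn_gcdr n (p ^ (k - 1))) => e le_e def_g.
have [u [au u0 _]] := aX e.
rewrite def_g au => /eqP.
rewrite -subr_eq0 addrAC subrr add0r p_expr_unit_eq0 //.
move=> le_ke; have <- : e = (k - 1)%N by lia.
by rewrite -def_g dvdn_gcdl.
Qed.

(** The exponent of the unit group is [M], one coprime factor at a time: the
    residue field gives [p ^ d - 1] and a single principal unit gives
    [p ^ (k - 1)]. *)
Lemma dvdn_exponent_units n : (0 < n)%N ->
  (forall x : R, rho x != 0 -> x ^+ n = 1) -> (M %| n)%N.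
Proof.
move=> n_gt0 xn1; rewrite Gauss_dvd; last first.
  have p_dvd_pd : (p %| p ^ d)%N by rewrite dvdn_exp // ltnW.
  rewrite coprimeXl // (coprime_dvdl p_dvd_pd) //.
  by rewrite subn1 coprimenP ?expn_gt0 ?p_gt0.
apply/andP; split; last first.
  apply: dvdn_card_units => // y y0; have [x def_y] := rho_surj y.
  by rewrite -def_y -rmorphXn xn1 ?rmorph1 // def_y.
have [z /andP[z0 z1]] := residue_neq0N1; have [y def_z] := rho_surj z.
apply: (@principal_unit_order y); rewrite ?def_z // xn1 //.
by rewrite rmorphD rmorphM rho_p mul0r addr0 rmorph1 oner_eq0.
Qed.

(** [1 - P ^+ n] is a unit, so the powers of [P] are periodic only once they
    vanish. *)
Lemma p_expr_periodic m n : (0 < n)%N -> P ^+ (m + n) = P ^+ m -> (k <= m)%N.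
Proof.
move=> n_gt0 /esym/eqP; rewrite -subr_eq0 exprD -{1}[P ^+ m]mulr1 -mulrBr.
rewrite p_expr_unit_eq0 // rmorphB rmorphXn rho_p rmorph1 expr0n gtn_eqF //.
by rewrite subr0 oner_eq0.
Qed.

(** * Onset and exponential period *)

Lemma mu_1E : mu_1 R = M.
Proof.
rewrite /mu_1; case: ex_minnP => n /asboolP[n_gt0 per_n] min_n.
apply/eqP; rewrite eqn_leq; apply/andP; split; last first.
  apply: (dvdn_leq n_gt0); apply: dvdn_exponent_units => // x x0.
  by have [m _ e] := per_n x; apply: unit_expr_cancel e.
apply: min_n; apply/asboolP; split; first exact: M_gt0.
by move=> x; exists k; [exact: k_gt0 | exact: expr_eventually_periodic].
Qed.

Lemma mu_0E : mu_0 R = k.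
Proof.
apply/eqP; rewrite eqn_leq /mu_0; apply/andP; split.
  apply/bigmax_leqP=> x _; case: ex_minnP => m _; apply.
  by rewrite k_gt0 mu_1E expr_eventually_periodic /=.
apply: (bigmax_sup P) => //; case: ex_minnP => m.
rewrite mu_1E => /andP[_ /eqP eP] _.
exact: p_expr_periodic eP.
Qed.

(** * Counting power maps *)

Definition power_map n : {ffun R -> R} := [ffun x => x ^+ n].

Local Notation N := (M + (k - 1))%N.

(** If exponents [m < n] give the same map, evaluation at [P] yields [k <= m]
    and evaluation at the units yields [M %| n - m], so [n > N]. *)
Lemma power_map_inj m n : (0 < m <= N)%N -> (0 < n <= N)%N ->
  power_map m = power_map n -> m = n.
Proof.
wlog lt_mn : m n / (m < n)%N => [th m_in n_in eq_mn|].
  by case: (ltngtP m n) => // lt; [apply: th | apply/esym/th].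
move=> /andP[m_gt0 _] /andP[_ le_n] /ffunP eq_mn; exfalso.
have def_n : n = (m + (n - m))%N by rewrite subnKC // ltnW.
have eq_x (x : R) : x ^+ (m + (n - m)) = x ^+ m.
  by have := eq_mn x; rewrite !ffunE -def_n.
have nm_gt0 : (0 < n - m)%N by rewrite subn_gt0.
have le_km := p_expr_periodic nm_gt0 (eq_x P).
have /(dvdn_leq nm_gt0) : (M %| n - m)%N.
  by apply: dvdn_exponent_units => // x x0; apply: unit_expr_cancel (eq_x x).
by move: le_n le_km lt_mn; clear -k_gt0; lia.
Qed.

Lemma power_map_small n : (0 < n)%N ->
  exists2 m, (0 < m <= N)%N & power_map n = power_map m.
Proof.
elim/ltn_ind: n => n IHn n_gt0; have [le_nN|lt_Nn] := leqP n N.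
  by exists n; rewrite ?n_gt0.
have le_kn : (k <= n - M)%N by move: lt_Nn; clear -k_gt0; lia.
have [| |m m_in eq_m] := IHn (n - M)%N.
- by move: lt_Nn M_gt0; clear; lia.
- exact: leq_trans le_kn.
exists m => //; rewrite -eq_m; apply/ffunP=> x; rewrite !ffunE.
rewrite -(expr_eventually_periodic _ le_kn) subnK //.
by move: lt_Nn; clear; lia.
Qed.

Lemma power_mapP (f : {ffun R -> R}) :
  reflect (exists2 n, (0 < n <= N)%N & f = power_map n) (f \in power_maps R).
Proof.
rewrite inE; apply: (iffP (asboolP _)) => [[n n_gt0 fE]|[n /andP[n_gt0 _] ->]].
  have [m m_in eq_m] := power_map_small n_gt0; exists m => //.
  by rewrite -eq_m; apply/ffunP=> x; rewrite fE ffunE.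
by exists n => // x; rewrite ffunE.
Qed.

Lemma card_power_maps : #|power_maps R| = N.
Proof.
have -> : power_maps R = [set power_map i.+1 | i : 'I_N].
  apply/setP=> f; apply/power_mapP/imsetP=> [[[|n] // n_in ->]|[i _ ->]].
    by exists (Ordinal n_in).
  by exists i.+1; rewrite /= ?ltn_ord.
rewrite card_imset ?card_ord // => i j /power_map_inj eq_ij.
by apply/val_inj/succn_inj/eq_ij; rewrite /= ltn_ord.
Qed.

(** A unit cannot be a period, as [0 ^+ n = 0]. If [h] in [(p)] is a period,
    then [(1 + h) ^+ n = 1]; since [1 + h] has order a power of [p], [n]
    coprime to [p] would force [h = 0]. Conversely, if [p] divides [n] then [P
    ^+ (k - 1)] is a period, because it is killed by [p] and its square is
    zero. *)
Lemma periodic_power_map n : (0 < n)%N ->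
  is_periodic (power_map n) <-> (p %| n)%N.
Proof.
move=> n_gt0; split=> [[h h_nz per_h]|/dvdnP[c ->]].
  have rho_h : rho h = 0.
    have := per_h 0; rewrite !ffunE add0r expr0n gtn_eqF //= => /(congr1 rho).
    by move/eqP; rewrite rmorphXn rmorph0 expf_eq0 n_gt0 => /eqP.
  have [y def_h] := rho_ker rho_h.
  have an1 : (1 + P * y) ^+ n = 1.
    by have := per_h 1; rewrite !ffunE expr1n def_h.
  apply: contraNT h_nz; rewrite -prime_coprime // => co_pn.
  have := expr_gcdn_eq1 an1 (principal_unit_exp y).
  rewrite (eqP (_ : coprime n _)); last by rewrite coprime_sym coprimeXl.
  by move/eqP; rewrite -subr_eq0 addrAC subrr add0r -def_h.
exists (P ^+ (k - 1)) => [|x]; first by rewrite p_expr_eq0 -ltnNge subn1 prednK.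
rewrite !ffunE mulnC !exprM exprDn big_ord_recl /= subn0 mulr1 bin0 mulr1n.
rewrite big1 ?addr0 // => [[i lt_i]] _ /=; rewrite /bump /= add1n.
case: i => [|i] in lt_i *.
  have /eqP Pk0 : P ^+ (k - 1).+1 == 0 by rewrite p_expr_eq0 -subSn ?subn1.
  by rewrite bin1 expr1 -mulr_natr -mulrA -exprSr Pk0 mulr0.
have /eqP -> : (P ^+ (k - 1)) ^+ i.+2 == 0; last by rewrite mulr0 mul0rn.
by rewrite -exprM p_expr_eq0; move: k_ge2; clear; nia.
Qed.

(** The multiples of [p] in the range of exponents where power maps are distinct
    are the [p * i.+1] for [i < N %/ p]. *)
Lemma mu_PE : mu_P R = (p ^ (k - 2) * (p ^ d - 1) + (k - 1) %/ p)%N.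
Proof.
have -> : (p ^ (k - 2) * (p ^ d - 1) + (k - 1) %/ p = N %/ p)%N.
  have -> : (k - 1 = (k - 2).+1)%N by move: k_ge2; clear; lia.
  by rewrite expnSr mulnAC divnMDl.
pose f (i : 'I_(N %/ p)) := power_map (p * i.+1).
have f_in (i : 'I_(N %/ p)) : (0 < p * i.+1 <= N)%N.
  rewrite muln_gt0 p_gt0 (leq_trans _ (leq_trunc_div N p)) // mulnC.
  by rewrite leq_mul2r ltn_ord orbT.
have -> : mu_P R = #|f @: setT|.
  congr #|pred_of_set _|; apply/setP=> g; rewrite inE.
  apply/andP/imsetP=> [[/power_mapP[n n_in ->] /asboolP]|[i _ ->]].
    have /andP[n_gt0 le_n] := n_in.
    move/(periodic_power_map n_gt0)/dvdnP=> [[|c] def_n].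
      by rewrite def_n in n_gt0.
    have lt_c : (c < N %/ p)%N by rewrite leq_divRL // -def_n.
    by exists (Ordinal lt_c); rewrite // /f /= mulnC -def_n.
  split; first by apply/power_mapP; exists (p * i.+1)%N.
  have /andP[i_gt0 _] := f_in i.
  by apply/asboolP/periodic_power_map; rewrite ?dvdn_mulr.
rewrite card_imset ?cardsT ?card_ord // => i j.
move/(power_map_inj (f_in i) (f_in j))/eqP.
by rewrite eqn_pmul2l // eqSS => /eqP/val_inj.
Qed.

End PowerMapsOfResidueRing.

Local Close Scope ring_scope.
Local Open Scope nat_scope.

Theorem mainTheorem7 (p d k : nat) (R : finComNzRingType)
    (p_prime : prime p) (d_ge2 : 2 <= d) (k_ge2 : 2 <= k)
    (R_galois : galois_ring p k d R) :
  [/\ mu_0 R = k,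
      mu_1 R = p ^ (k - 1) * (p ^ d - 1),
      #|power_maps R| = p ^ (k - 1) * (p ^ d - 1) + k - 1 &
      mu_P R = p ^ (k - 2) * (p ^ d - 1) + (k - 1) %/ p].
Proof.
have k_gt0 : 0 < k by apply: ltnW.
have [natr0 [F [rho [card_F rho_surj rho_ker]]]] :=
  galois_ring_residue p_prime k_gt0 R_galois.
split.
- exact: mu_0E natr0 card_F rho_surj rho_ker.
- exact: mu_1E natr0 card_F rho_surj rho_ker.
- rewrite -addnBA //.
  exact: card_power_maps natr0 card_F rho_surj rho_ker.
- exact: mu_PE natr0 card_F rho_surj rho_ker.
Qed.
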